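(* For every $n \in \mathbb{N}$ (that is, $n\ge 1$), the maximum size (number of points $m$) of a right-equidistant sequence $\mathbf{x}^{(1)},\dots,\mathbf{x}^{(m)}$ of points in $\mathbb{R}^n_{\infty}$ equals $2^{n+1}-1$.
   Context: $\mathbb{R}^n_{\infty}$ denotes $\mathbb{R}^n$ equipped with the maximum metric $\|\mathbf{x}-\mathbf{y}\|_{\infty} = \max_{1\le i\le n} |x_i-y_i|$. A sequence $\mathbf{x}^{(1)},\dots,\mathbf{x}^{(m)}$ of distinct points in $\mathbb{R}^n_\infty$ is called right-equidistant if $\|\mathbf{x}^{(j_1)}-\mathbf{x}^{(i)}\|_{\infty} = \|\mathbf{x}^{(j_2)}-\mathbf{x}^{(i)}\|_{\infty}$ for all $1 \le i < j_1 \le j_2 \le m$; that is, each point of the sequence is at the same distance from all the succeeding points. *)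

(* Defs.v *)
From mathcomp Require Import all_boot all_order all_algebra.
From mathcomp Require Import all_classical all_reals all_analysis.

Set Implicit Arguments.
Unset Strict Implicit.
Unset Printing Implicit Defensive.

Import Order.TTheory GRing.Theory Num.Theory numFieldNormedType.Exports.

Local Open Scope ring_scope.

(* The canonical norm on ['rV[R]_n] is the maximum norm (see [mx_normrE]). *)
Definition right_equidistant (R : realType) (n m : nat)
    (x : 'I_m -> 'rV[R]_n) : Prop :=
  injective x /\
  forall i j1 j2 : 'I_m, (i < j1)%N -> (j1 <= j2)%N ->
    `|x j1 - x i| = `|x j2 - x i|.

(* Main.v *)
(* Write [d i] for the distance from the [i]-th point to all later ones.  The
   triangle inequality gives [d j <= 2 * d i] for [i < j].

   If a subsequence has [d j < 2 * d i] for all [i < j], then in each coordinate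
   the graph of the pairs [i < j] whose coordinates differ by exactly [d i] is
   bipartite; every pair is an edge in some coordinate, so [n] two-colourings
   separate all the points and there are at most [2 ^ n] of them.  In general
   [d j = 2 * d i] and [d k = 2 * d j] cannot both hold for [i < j < k], so
   sorting the points other than the last by whether their distance is doubled
   later yields two such subsequences; adding the last point to both of them
   gives [m + 1 <= 2 * 2 ^ n].

   The bound is attained by taking the points [t *: v] and [2 * t *: v] on the ray
   of each nonzero 0/1 vector [v], at a scale [t] that halves from one ray to the
   next, followed by the origin.  The rays come in an order such that no [v]
   lies below a later [w]: then [v] is 1 at some coordinate where [w] is 0, and
   there a point on the ray of [v] attains its distance to the later ones. *)
Require Import Defs.
From mathcomp Require Import all_boot all_order all_algebra.
From mathcomp Require Import all_classical all_reals all_analysis.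
From mathcomp Require Import zify lra.

Set Implicit Arguments.
Unset Strict Implicit.
Unset Printing Implicit Defensive.

Import Order.TTheory GRing.Theory Num.Theory numFieldNormedType.Exports.

Local Open Scope ring_scope.

Lemma ler_coord_norm (R : realType) n (x : 'rV[R]_n) k : `|x 0 k| <= `|x|.
Proof.
rewrite [leRHS]/Num.norm /= mx_normrE.
exact: (le_bigmax _ (fun ij => `|x ij.1 ij.2|) (0, k)).
Qed.

Lemma norm_attained (R : realType) n (x : 'rV[R]_n) :
  0 < `|x| -> exists k, `|x 0 k| = `|x|.
Proof.
move=> x0; have /mx_norm_neq0[[i k] /= xE] : mx_norm x != 0 by rewrite gt_eqF.
by exists k; rewrite [RHS]xE (ord1 i).
Qed.

Lemma norm_eq (R : realType) n (x : 'rV[R]_n) c :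
  (forall k, `|x 0 k| <= c) -> (exists k, `|x 0 k| = c) -> `|x| = c.
Proof.
move=> xc [k xk]; apply/eqP; rewrite eq_le -{2}xk ler_coord_norm andbT.
have c0 : 0 <= c by rewrite -xk.
rewrite [leLHS]/Num.norm /= mx_normrE; apply/bigmax_leP; split=> // -[i l] _ /=.
by rewrite (ord1 i).
Qed.

(* Induction from the last point backwards, requiring all points at the minimum
   to be coloured [false] and all those at the maximum [true].  As the later
   points have diameter below [2 * d i], a new point [i] can be at distance [d i]
   from their minimum or from their maximum but not from both, so comparing it
   with the midpoint colours it correctly. *)
Lemma bipartite_coloring (R : realFieldType) (y d : nat -> R) (s : seq nat) :
  s != [::] -> sorted ltn s ->
  (forall i j, i \in s -> j \in s -> (i < j)%N -> 0 < d i) ->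
  (forall i j, i \in s -> j \in s -> (i < j)%N -> `|y j - y i| <= d i) ->
  (forall i j k, i \in s -> j \in s -> k \in s -> (i < j)%N -> (j < k)%N ->
    `|y k - y j| < 2 * d i) ->
  exists (c : nat -> bool) (l h : nat),
    [/\ l \in s, h \in s, (forall i, i \in s -> y l <= y i <= y h),
        (y l < y h -> forall i, i \in s ->
           (y i = y l -> ~~ c i) /\ (y i = y h -> c i)) &
        forall i j, i \in s -> j \in s -> (i < j)%N ->
          `|y j - y i| = d i -> c i != c j].
Proof.
elim: s => // i [_ _ _ _ _ _|i' s].
  exists xpredT, i, i; split; rewrite ?mem_head//.
  - by move=> j; rewrite inE => /eqP->; rewrite lexx.
  - by rewrite ltxx.
  - by move=> j k; rewrite !inE => /eqP-> /eqP->; rewrite ltnn.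
move: (i' :: s) (isT : i' :: s != [::]) => {i'}s s0 IH _ is_sorted d_gt0.
move=> ydle ydlt.
have in_tl j : j \in s -> j \in i :: s by rewrite inE orbC => ->.
have i_lt j : j \in s -> (i < j)%N.
  by move=> js; apply: (allP (order_path_min ltn_trans is_sorted)).
have [|j k js ks|j k js ks|j k u js ks us|c [l [h [ls hs lh cP cN]]]] := IH s0.
- exact: path_sorted is_sorted.
- by apply: d_gt0; apply: in_tl.
- by apply: ydle; apply: in_tl.
- by apply: ydlt; apply: in_tl.
have i_head : i \in i :: s by rewrite mem_head.
have di_gt0 : 0 < d i by apply: (d_gt0 _ l) => //; [exact: in_tl | exact: i_lt].
have i_near j : j \in s -> `|y j - y i| <= d i.
  by move=> js; apply: ydle => //; [exact: in_tl | exact: i_lt].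
have diam : y h - y l < 2 * d i.
  have [lt_lh|lt_hl|->] := ltngtP l h; last by rewrite subrr mulr_gt0.
  - apply: le_lt_trans (ler_norm _) _.
    exact: (ydlt i l h i_head (in_tl _ ls) (in_tl _ hs) (i_lt _ ls)).
  - apply: le_lt_trans (ler_norm _) _; rewrite distrC.
    exact: (ydlt i h l i_head (in_tl _ hs) (in_tl _ ls) (i_lt _ hs)).
pose l' := if y i < y l then i else l; pose h' := if y h < y i then i else h.
have l's : l' \in i :: s by rewrite /l'; case: ifP => // _; exact: in_tl.
have h's : h' \in i :: s by rewrite /h'; case: ifP => // _; exact: in_tl.
have lh' j : j \in i :: s -> y l' <= y j <= y h'.
  rewrite /l' /h' inE => /predU1P[->|/lh].
    by have := lh _ ls; case: (ltP (y i) (y l)); case: (ltP (y h) (y i)); lra.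
  by case: (ltP (y i) (y l)); case: (ltP (y h) (y i)); have := lh _ ls; lra.
(* When all later values coincide, [cP] is vacuous and [c] is arbitrary on them, so it is replaced
   by a fresh colouring. *)
have [yE|y_neq] := eqVneq (y l) (y h).
  have yC j : j \in s -> y j = y l by move=> /lh; lra.
  exists (fun j => y l' < y j), l', h'; split=> //.
    move=> lt_lh' j js; split=> ->; rewrite ?ltxx//.
  move=> j k; rewrite inE => /predU1P[->|js] ks lt_jk ydE; last first.
    have k_s : k \in s.
      by case/predU1P: ks => // kE; have := i_lt _ js; rewrite /= -kE ltnNge ltnW.
    have := d_gt0 _ _ (in_tl _ js) (in_tl _ k_s) lt_jk.
    by rewrite -ydE (yC _ js) (yC _ k_s) subrr normr0 ltxx.
  case/predU1P: ks lt_jk ydE => [->|ks]; first by rewrite ltnn.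
  move=> _; rewrite (yC _ ks) /l' => ydE.
  case: (ltgtP (y i) (y l)) => [lt_il|lt_li|yiE]; rewrite ?lt_il ?lt_li ?ltxx//.
  by move: di_gt0; rewrite -ydE yiE subrr normr0 !ltxx.
have y_lt : y l < y h by rewrite lt_neqAle y_neq; case/andP: (lh _ ls).
exists (fun j => if j == i then y l + y h < 2 * y i else c j), l', h'; split=> //.
  move=> _ j; rewrite inE; case: eqP => [-> _|_ /= js].
    by rewrite /l' /h'; case: (ltP (y i) (y l)); case: (ltP (y h) (y i)); split; lra.
  have [cl ch] := cP y_lt _ js; have /andP[yl yh] := lh _ js.
  rewrite /l' /h'; split => yjE.
    by apply: cl; move: yjE; case: (ltP (y i) (y l)); lra.
  by apply: ch; move: yjE; case: (ltP (y h) (y i)); lra.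
have neq_i j : j \in s -> (j == i) = false.
  by move=> /i_lt ij; apply/negbTE; rewrite neq_ltn ij orbT.
move=> j k; rewrite !inE => /predU1P[->|js] /predU1P[->|ks]; rewrite ?ltnn//.
- rewrite eqxx neq_i// => _ ydE.
  have [cl ch] := cP y_lt _ ks; have /andP[yl yh] := lh _ ks.
  have := i_near _ ls; have := i_near _ hs; rewrite !ler_norml => nh nl.
  (* If [y k] lies above [y i], then [y h - y i <= d i] forces [y k = y h], and [diam] puts [y i]
     below the midpoint; the other case is symmetric. *)
  have [|] := lerP 0 (y k - y i) => yki; move: ydE.
    rewrite ger0_norm// => ydE; rewrite ch; last by lra.
    by case: ltP => //; lra.
  rewrite ltr0_norm// => ydE; rewrite (negbTE (cl _)); last by lra.
  by case: ltP => //; lra.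
- by move=> /(ltn_trans (i_lt _ js)); rewrite ltnn.
- by rewrite !neq_i//; apply: cN.
Qed.

Lemma size_le_exp2 (R : realType) n (x : nat -> 'rV[R]_n)
    (d : nat -> R) (s : seq nat) :
  sorted ltn s ->
  (forall i j, i \in s -> j \in s -> (i < j)%N -> 0 < d i) ->
  (forall i j, i \in s -> j \in s -> (i < j)%N -> `|x j - x i| = d i) ->
  (forall i j k, i \in s -> j \in s -> k \in s -> (i < j)%N -> (j < k)%N ->
    d j < 2 * d i) ->
  (size s <= 2 ^ n)%N.
Proof.
move=> s_sorted d_gt0 xd dlt.
have [->//|s0] := eqVneq s [::].
have coordE i j k : x j 0 k - x i 0 k = (x j - x i) 0 k by rewrite !mxE.
have /choice[c cP] (k : 'I_n) : exists c : nat -> bool,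
    forall i j, i \in s -> j \in s -> (i < j)%N ->
      `|x j 0 k - x i 0 k| = d i -> c i != c j.
  have [|i j si sj ij|i j u si sj su ij ju|c [? [? [_ _ _ _ cN]]]] :=
    @bipartite_coloring R (fun i => x i 0 k) d s s0 s_sorted; last by exists c.
  - exact: d_gt0.
  - by rewrite coordE -(xd _ _ si sj ij) ler_coord_norm.
  - apply: le_lt_trans (dlt _ _ _ si sj su ij ju).
    by rewrite coordE -(xd _ _ sj su ju) ler_coord_norm.
pose f i := [ffun k => c k i].
have f_neq i j : i \in s -> j \in s -> (i < j)%N -> f i != f j.
  move=> si sj ij; have xdE := xd _ _ si sj ij.
  have [|k kE] := @norm_attained _ _ (x j - x i).
    by rewrite xdE (d_gt0 _ _ si sj).
  apply/eqP => /ffunP/(_ k); rewrite !ffunE; apply/eqP/cP => //.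
  by rewrite coordE kE.
rewrite -(size_map f).
have /card_uniqP <- : uniq (map f s).
  rewrite map_inj_in_uniq ?(sorted_uniq ltn_trans ltnn)// => i j si sj fij.
  have [ij|ji|//] := ltngtP i j.
  - by have := f_neq _ _ si sj ij; rewrite fij eqxx.
  - by have := f_neq _ _ sj si ji; rewrite fij eqxx.
apply: leq_trans (max_card _) _.
by rewrite card_ffun card_bool card_ord.
Qed.

Lemma right_equidistant_bound (R : realType) n m (x : 'I_m -> 'rV[R]_n) :
  right_equidistant x -> (m <= 2 ^ n.+1 - 1)%N.
Proof.
case: m x => // p x [x_inj x_eq].
pose X i := x (inord i : 'I_p.+1); pose d i := `|X p - X i|.
have inordE i : (i <= p)%N -> (inord i : 'I_p.+1) = i :> nat by exact: inordK.
have Xd i j : (i < j)%N -> (j <= p)%N -> `|X j - X i| = d i.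
  by move=> ij jp; apply: x_eq; rewrite !inordE//; lia.
have d_gt0 i : (i < p)%N -> 0 < d i.
  move=> ip; rewrite normr_gt0 subr_eq0; apply/eqP => /x_inj /(congr1 val) /=.
  by rewrite !inordE//; lia.
have d_le i j : (i < j)%N -> (j < p)%N -> d j <= 2 * d i.
  move=> ij jp; have := ler_distD (X i) (X p) (X j).
  rewrite (distrC (X i)) (Xd i j ij (ltnW jp)) -/(d i) -/(d j); lra.
pose a i := has (fun j => (i < j < p)%N && (d j == 2 * d i)) (iota 0 p).
have bound (P : pred nat) :
    (forall i j, (i < j < p)%N -> P i -> P j -> d j != 2 * d i) ->
    (count P (iota 0 p.+1) <= 2 ^ n)%N.
  move=> P_neq; rewrite -size_filter.
  apply: (@size_le_exp2 _ _ X d).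
  - by apply: sorted_filter; [exact: ltn_trans | exact: iota_ltn_sorted].
  - move=> i j _; rewrite mem_filter mem_iota => /andP[_ jp] ij; apply: d_gt0; lia.
  - by move=> i j _; rewrite mem_filter mem_iota => /andP[_ jp] ij; apply: Xd; lia.
  - move=> i j k; rewrite !mem_filter !mem_iota.
    move=> /andP[Pi _] /andP[Pj _] /andP[_ kp] ij jk.
    by rewrite lt_neqAle P_neq ?d_le//; lia.
(* The two classes cover all [p.+1] indices and share only [p], so their sizes add up to [p + 2]. *)
have := count_predUI (fun i => a i || (i == p)) (fun i => ~~ a i || (i == p))
  (iota 0 p.+1).
rewrite (@eq_count _ _ predT); last by move=> i /=; case: (a i); rewrite ?orbT.
rewrite count_predT size_iota (@eq_count _ (predI _ _) (pred1 p)); last first.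
  by move=> i /=; case: (a i); case: (i == p).
rewrite count_uniq_mem ?iota_uniq// mem_iota leq0n add0n ltnSn -[nat_of_bool _]/1%N.
(* Two doublings in a row would give [d k = 4 * d i], against [d_le]. *)
have A : (count (fun i => a i || (i == p)) (iota 0 p.+1) <= 2 ^ n)%N.
  apply: bound => i j ijp; rewrite (@ltn_eqF j)//; last by lia.
  rewrite orbF => _ /hasP[k _ /andP[jkp /eqP dk]]; apply/eqP => dj.
  have := d_le i k; have := d_gt0 i; rewrite dk dj.
  case/andP: ijp => ij jp; case/andP: jkp => jk kp.
  by move=> /(_ (ltn_trans ij jp)) ? /(_ (ltn_trans ij jk) kp); lra.
have B : (count (fun i => ~~ a i || (i == p)) (iota 0 p.+1) <= 2 ^ n)%N.
  apply: bound => i j ijp; rewrite (@ltn_eqF i p)//; last by lia.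
  rewrite orbF => /hasPn ai _; have := ai j; rewrite ijp mem_iota; apply; lia.
by rewrite expnS; lia.
Qed.

(** Halve both numbers until the halves agree: the lowest bits then differ. Listing 0/1 vectors by
    decreasing binary code thus puts none of them below a later one. *)
Lemma ltn_bit n N M : (M < N)%N -> (N < 2 ^ n)%N ->
  exists k : 'I_n, odd (N %/ 2 ^ k) && ~~ odd (M %/ 2 ^ k).
Proof.
elim: n N M => [|n IH] N M; first by rewrite expn0; lia.
rewrite expnS => MN Nn.
have [h|h] := boolP (M %/ 2 < N %/ 2)%N.
  have [|k kP] := IH _ _ h; first by lia.
  by exists (lift ord0 k); rewrite lift0 expnS !divnMA.
by exists ord0; rewrite expn0 !divn1; lia.
Qed.

Theorem theorem2 (R : realType) (n : nat) (hn : (1 <= n)%N) :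
  (exists x : 'I_(2 ^ n.+1 - 1)%N -> 'rV[R]_n, right_equidistant x) /\
  (forall (m : nat) (x : 'I_m -> 'rV[R]_n),
     right_equidistant x -> (m <= 2 ^ n.+1 - 1)%N).
Proof.
split; last by move=> m x; exact: right_equidistant_bound.
(* Indices [2 * r] and [2 * r + 1] share the ray whose direction is the binary expansion of [N i];
   the last index is even and has [N i = 0], the origin. *)
pose N i := (2 ^ n - 1 - i %/ 2)%N.
pose c i : R := (if odd i then 2 else 1) / 2 ^+ (i %/ 2).
pose x (i : 'I_(2 ^ n.+1 - 1)%N) : 'rV[R]_n :=
  \row_k (c i * (odd (N i %/ 2 ^ k))%:R).
have c_gt0 i : 0 < c i by rewrite divr_gt0 ?exprn_gt0//; case: odd.
have c_le i j : (i %/ 2 < j %/ 2)%N -> c j <= c i.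
  move=> ij; rewrite /c ler_pdivrMr ?exprn_gt0// mulrAC ler_pdivlMr ?exprn_gt0//.
  have -> : (j %/ 2 = i %/ 2 + (j %/ 2 - i %/ 2).-1.+1)%N by lia.
  rewrite exprD exprS; set u := 2 ^+ (i %/ 2); set q := 2 ^+ _.-1.
  have u_gt0 : 0 < u by rewrite exprn_gt0.
  have : u <= u * q by rewrite ler_peMr ?exprn_ege1 ?ler1n// ltW.
  by case: (odd i); case: (odd j); lra.
have xd (i j : 'I_(2 ^ n.+1 - 1)%N) : (i < j)%N -> `|x j - x i| = c i.
  move=> ij; have jn : (j < 2 * 2 ^ n - 1)%N by rewrite -expnS ltn_ord.
  have ci := c_gt0 i.
  have [ij2|ij2] := eqVneq (i %/ 2)%N (j %/ 2)%N.
    have [io jo] : odd i = false /\ odd j = true by split; lia.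
    have NE : N j = N i by rewrite /N ij2.
    have cE : c j = 2 * c i by rewrite /c io jo ij2 mulrA mulr1.
    have xE k : (x j - x i) 0 k = c i * (odd (N i %/ 2 ^ k))%:R.
      by rewrite !mxE cE NE; lra.
    apply: norm_eq => [k|].
      rewrite xE; case: odd; rewrite ?mulr1 ?mulr0 ?normr0 ?gtr0_norm//; exact: ltW.
    (* The origin has no partner on its ray, so [N i] is nonzero and has a bit 1. *)
    have [||k /andP[ko _]] := @ltn_bit n (N i) 0; rewrite /N; [lia..|].
    by exists k; rewrite xE ko mulr1 gtr0_norm.
  have {}ij2 : (i %/ 2 < j %/ 2)%N by lia.
  have cj := c_gt0 j; have cji := c_le _ _ ij2.
  apply: norm_eq => [k|].
    by rewrite !mxE ler_norml; case: odd; case: odd; rewrite ?mulr1 ?mulr0; lra.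
  have [||k /andP[io /negbTE jo]] := @ltn_bit n (N i) (N j); rewrite /N; [lia..|].
  by exists k; rewrite !mxE /N io jo mulr0 mulr1 sub0r normrN gtr0_norm.
exists x; split=> [i j xij|i j k ij jk]; last by rewrite !xd// (leq_trans ij).
apply/val_inj; have [ij|ji|//] := ltngtP (i : nat) j.
- by have := c_gt0 i; rewrite -(xd _ _ ij) xij subrr normr0 ltxx.
- by have := c_gt0 j; rewrite -(xd _ _ ji) xij subrr normr0 ltxx.
Qed.
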